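(* Let $X$ be a real Banach space. The following are equivalent: (1) $X$ satisfies property (CS), i.e. every convex combination of slices of $B_X$ intersects the unit sphere $S_X$. (2) For every convex combination of slices $C$ of $B_X$ there are $x,y\in C$ such that $\Vert x-y\Vert=2$.
   Context: All Banach spaces are real. $B_X$ and $S_X$ denote the closed unit ball and the unit sphere of $X$, and $X^*$ is the topological dual. A slice of $B_X$ is a set $S(B_X,f,\alpha):=\{x\in B_X: f(x)>1-\alpha\}$ with $f\in S_{X^*}$ and $\alpha>0$. A convex combination of slices of $B_X$ is a set $\sum_{i=1}^n\lambda_i S_i$ (Minkowski sum), where $\lambda_1,\dots,\lambda_n\in[0,1]$, $\sum_{i=1}^n\lambda_i=1$, and each $S_i$ is a slice of $B_X$. *)

(* Defs.v *)
From HB Require Import structures.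
From mathcomp Require Import all_boot all_order all_algebra.
From mathcomp Require Import boolp classical_sets reals topology normedtype.

Set Implicit Arguments.
Unset Strict Implicit.
Unset Printing Implicit Defensive.

Import Order.TTheory GRing.Theory Num.Theory.
Import numFieldNormedType.Exports.

Local Open Scope classical_set_scope.
Local Open Scope ring_scope.

Definition unit_ball (R : realType) (X : normedModType R) : set X :=
  [set x | `|x| <= 1].
Arguments unit_ball {R} X _.

Definition unit_sphere (R : realType) (X : normedModType R) : set X :=
  [set x | `|x| = 1].
Arguments unit_sphere {R} X _.

(* [sup] is 0 on unbounded sets, so this is the norm of the dual space only
   when [f] is continuous. *)
Definition dual_norm (R : realType) (X : normedModType R)
    (f : {linear X -> R^o}) : R :=
  sup [set `|f x| | x in unit_ball X].

Definition dual_unit_sphere (R : realType) (X : normedModType R) :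
    set {linear X -> R^o} :=
  [set f : {linear X -> R^o} | continuous f /\ dual_norm f = 1].
Arguments dual_unit_sphere {R} X _.

Definition slice (R : realType) (X : normedModType R)
    (f : {linear X -> R^o}) (alpha : R) : set X :=
  [set x | unit_ball X x /\ 1 - alpha < f x].

Definition is_slice (R : realType) (X : normedModType R) (S : set X) : Prop :=
  exists (f : {linear X -> R^o}) (alpha : R),
    [/\ dual_unit_sphere X f, 0 < alpha & S = slice f alpha].

Definition weighted_sum (R : realType) (X : normedModType R) (n : nat)
    (lambda : 'I_n -> R) (S : 'I_n -> set X) : set X :=
  [set \sum_(i < n) lambda i *: x i | x in [set x | forall i, S i (x i)]].

(* The case n = 0 is ruled out by the condition that the weights sum to 1. *)
Definition convex_combination_of_slices (R : realType) (X : normedModType R)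
    (C : set X) : Prop :=
  exists (n : nat) (lambda : 'I_n -> R) (S : 'I_n -> set X),
    [/\ forall i, 0 <= lambda i <= 1,
        \sum_(i < n) lambda i = 1,
        forall i, is_slice (S i) &
        C = weighted_sum lambda S].

Definition property_CS (R : realType) (X : normedModType R) : Prop :=
  forall C : set X,
    convex_combination_of_slices C -> C `&` unit_sphere X !=set0.

(* Main.v *)
Require Import Defs.
From HB Require Import structures.
From mathcomp Require Import all_boot all_order all_algebra.
From mathcomp Require Import boolp classical_sets reals topology normedtype.

(** If [x] and [y] lie in the unit ball and [`|x - y| = 2], then the triangle
    inequality forces [`|x| = `|y| = 1]. As a convex combination of slices lies
    in the unit ball, two of its points at distance 2 are automatically on the
    unit sphere, which gives (CS).

    Conversely, if [S] is the slice given by [f], then [- S] is the slice given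
    by [- f], with the same width. Hence, for [C = \sum_i lambda_i S_i], the set
    [(C - C) / 2 = \sum_i (lambda_i / 2) S_i + \sum_i (lambda_i / 2) (- S_i)]
    is again a convex combination of slices (lemma [half_difference_slices]).
    By (CS) it contains a point [(x - y) / 2] of norm 1, with [x] and [y] in
    [C], that is, [`|x - y| = 2]. *)

Import Order.TTheory GRing.Theory Num.Theory.
Import numFieldNormedType.Exports.

Local Open Scope classical_set_scope.
Local Open Scope ring_scope.

Lemma weighted_sum_unit_ball (R : realType) (X : normedModType R) (n : nat)
    (lambda : 'I_n -> R) (S : 'I_n -> set X) :
  (forall i, 0 <= lambda i) -> \sum_(i < n) lambda i = 1 ->
  (forall i, S i `<=` unit_ball X) ->
  weighted_sum lambda S `<=` unit_ball X.
Proof.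
move=> lambda_ge0 sum_lambda S_ball _ [x Sx <-]; rewrite /unit_ball /=.
rewrite (le_trans (ler_norm_sum _ _ _))// -sum_lambda ler_sum// => i _.
by rewrite normrZ ger0_norm// ler_piMr//; exact/S_ball/Sx.
Qed.

Lemma convex_combination_unit_ball (R : realType) (X : normedModType R)
    (C : set X) :
  convex_combination_of_slices C -> C `<=` unit_ball X.
Proof.
move=> [n [lambda [S [lambda01 sum_lambda sliceS ->]]]].
apply: weighted_sum_unit_ball => // i; first by case/andP: (lambda01 i).
by have [f [a [_ _ ->]]] := sliceS i; move=> x [].
Qed.

Lemma diametral_unit_sphere (R : realType) (X : normedModType R) (x y : X) :
  unit_ball X x -> unit_ball X y -> `|x - y| = 2 -> unit_sphere X x.
Proof.
rewrite /unit_ball /unit_sphere /= => x_le1 y_le1 xy2.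
apply/eqP; rewrite eq_le x_le1 /= -(lerD2r 1) -[1 + 1]/(2 : R) -xy2.
by rewrite (le_trans (ler_normB _ _))// lerD2l.
Qed.

Lemma dual_unit_sphereN (R : realType) (X : normedModType R)
    (f : {linear X -> R^o}) :
  dual_unit_sphere X f -> dual_unit_sphere X (\- f : {linear X -> R^o}).
Proof.
move=> [f_cont f_norm]; split; first by move=> x; apply: cvgN; exact: f_cont.
rewrite -f_norm; congr sup; apply/seteqP.
by split=> _ [x Bx <-]; exists x => //=; rewrite normrN.
Qed.

Lemma is_sliceN (R : realType) (X : normedModType R) (S : set X) :
  is_slice S -> is_slice [set - x | x in S].
Proof.
move=> [f [a [f_sphere a_gt0 ->]]]; exists (\- f : {linear X -> R^o}), a.
split=> //; first exact: dual_unit_sphereN.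
rewrite /slice /unit_ball; apply/seteqP;
  split=> [_ [x [Bx fx] <-]|x [Bx fx]] /=.
  by rewrite normrN linearN opprK.
by exists (- x); rewrite ?opprK//=; rewrite normrN linearN.
Qed.

(** A point of [(C - C) / 2] involves two unrelated points of each slice [S_i],
    one for each copy of [C]. The index set is therefore doubled, so that [S_i]
    and [- S_i] are sampled independently, each with half of the weight. *)
Lemma half_difference_slices (R : realType) (X : normedModType R) (C : set X) :
  convex_combination_of_slices C ->
  convex_combination_of_slices
    [set z | exists x y : X, [/\ C x, C y & z = 2^-1 *: (x - y)]].
Proof.
move=> [n [lambda [S [lambda01 sum_lambda sliceS ->]]]].
exists (n + n)%N.
exists (fun i => match split i with inl j | inr j => 2^-1 * lambda j end).
exists (fun i => match split i with
                 | inl j => S j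
                 | inr j => [set - x | x in S j]
                 end).
have split_lshift (j : 'I_n) : split (lshift n j) = inl j := unsplitK (inl j).
have split_rshift (j : 'I_n) : split (rshift n j) = inr j := unsplitK (inr j).
have half01 j : 0 <= 2^-1 * lambda j <= 1.
  have /andP[lambda_ge0 lambda_le1] := lambda01 j.
  by rewrite mulr_ge0 ?invr_ge0//= mulr_ile1 ?invr_ge0// invf_le1// ler1n.
split.
- by move=> i; case: (split i).
- rewrite big_split_ord/=.
  under eq_bigr do rewrite split_lshift.
  under [X in _ + X]eq_bigr do rewrite split_rshift.
  by rewrite -mulr_sumr sum_lambda mulr1 [RHS]splitr div1r.
- by move=> i; case: (split i) => j //; exact: is_sliceN.
apply/seteqP; split=> [_ [_ [_ [[x Sx <-] [y Sy <-] ->]]]|_ [z Sz <-]].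
- exists (fun i => match split i with inl j => x j | inr j => - y j end).
    by move=> i; case: (split i) => j; [exact: Sx|exists (y j)].
  rewrite big_split_ord/= scalerBr !scaler_sumr -sumrN.
  congr (_ + _); apply: eq_bigr => j _; rewrite ?(split_lshift, split_rshift).
    by rewrite scalerA.
  by rewrite scalerA scalerN.
- exists (\sum_(j < n) lambda j *: z (lshift n j)).
  exists (\sum_(j < n) lambda j *: - z (rshift n j)); split.
  + exists (fun j => z (lshift n j)) => //= j.
    by have := Sz (lshift n j); rewrite split_lshift.
  + exists (fun j => - z (rshift n j)) => //= j.
    by have := Sz (rshift n j); rewrite split_rshift => -[x Sx <-];
      rewrite opprK.
  rewrite big_split_ord/= scalerBr !scaler_sumr -sumrN.
  congr (_ + _); apply: eq_bigr => j _; rewrite ?(split_lshift, split_rshift).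
    by rewrite scalerA.
  by rewrite scalerA scalerN opprK.
Qed.

Theorem theorem3p4 (R : realType) (X : completeNormedModType R) :
  property_CS X <->
  (forall C : set X, convex_combination_of_slices C ->
     exists x y : X, [/\ C x, C y & `|x - y| = 2]).
Proof.
split=> [CS C /half_difference_slices/CS | diam C C_slices].
- move=> [_ [[x [y [Cx Cy ->]]]]]; rewrite /unit_sphere /= normrZ.
  rewrite ger0_norm ?invr_ge0// => /(congr1 ( *%R 2)).
  by rewrite mulVKf ?pnatr_eq0// mulr1; exists x, y.
- have [x [y [Cx Cy xy2]]] := diam C C_slices.
  have C_ball := convex_combination_unit_ball _ _ _ C_slices.
  exists x; split=> //.
  exact: (diametral_unit_sphere _ _ _ _ (C_ball _ Cx) (C_ball _ Cy)).
Qed.
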